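(* Let $a,b\in(0,1)$ and let $\sigma=\sigma_0\cdots\sigma_{n-1}$ be an admissible pattern, with $\mathcal{P}_\sigma=(\mu_1,\mu_2]$, where $\mu_1$ is the maximum of the lower bounds for $\mu$ arising from the inequalities $x_i>0$ at the positions $i$ with $\sigma_i=\mathcal{R}$, and $\mu_2$ is the minimum of the upper bounds for $\mu$ arising from the inequalities $x_i\le 0$ at the positions $i$ with $\sigma_i=\mathcal{L}$. Then: (i) $\mu_1$ is the lower bound arising from the position of $\sigma$ that becomes the last position (an $\mathcal{R}$) when $\sigma$ is cyclically shifted to its $\mathcal{R}$-way arranged pattern; (ii) $\mu_2$ is the upper bound arising from the position of $\sigma$ that becomes the last position (an $\mathcal{L}$) when $\sigma$ is cyclically shifted to its $\mathcal{L}$-way arranged pattern.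
   Context: For $a,b\in(0,1)$ and $\mu\in(0,1)$ consider the map $f_\mu:\mathbb{R}\to\mathbb{R}$, $f_\mu(x)=ax+\mu$ if $x\le 0$, and $f_\mu(x)=bx+\mu-1$ if $x>0$. A point $p$ is periodic of period $k$ if $f_\mu^k(p)=p$ and $k$ is the smallest such positive integer; its orbit is then a periodic orbit of period $k$. Let $\mathcal{L}=(-\infty,0]$ and $\mathcal{R}=(0,\infty)$. A periodic orbit $x_0,\dots,x_{k-1}$ of period $k$ is coded by the string $\sigma=\sigma_0\cdots\sigma_{k-1}$ with $\sigma_i=\mathcal{L}$ if $x_i\in\mathcal{L}$ and $\sigma_i=\mathcal{R}$ if $x_i\in\mathcal{R}$. This string, considered up to cyclic shift, is called the pattern of the orbit; its length is the period $k$. $\mathcal{P}_\sigma$ denotes the set of $\mu\in(0,1)$ for which $f_\mu$ has a periodic orbit with pattern $\sigma$, and $\sigma$ is called admissible (for the given $a,b$) if $\mathcal{P}_\sigma\ne\emptyset$. Bounds arising from positions: given $\sigma=\sigma_0\cdots\sigma_{n-1}$, let $x_0(\mu),\dots,x_{n-1}(\mu)$ be the unique solution of the cyclic affine system $x_{i+1}=ax_i+\mu$ if $\sigma_i=\mathcal{L}$, $x_{i+1}=bx_i+\mu-1$ if $\sigma_i=\mathcal{R}$ (indices mod $n$). Each $x_i(\mu)$ is affine in $\mu$ with positive slope. If $\sigma_i=\mathcal{L}$, the inequality $x_i(\mu)\le0$ is equivalent to an upper bound $\mu\le\mu_i^{upper}$; if $\sigma_i=\mathcal{R}$, the inequality $x_i(\mu)>0$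 is equivalent to a lower bound $\mu>\mu_i^{lower}$. These are the bounds arising from position $i$. Arrangements: form the binary sequence $\mathfrak{F}(\sigma)$ by substituting $0$ for $\mathcal{L}$ and $1$ for $\mathcal{R}$. Among all cyclic shifts of $\mathfrak{F}(\sigma)$, the one that is the largest binary number is called the $\mathcal{L}$-way arranged pattern (it begins with $\mathcal{R}$ and ends with $\mathcal{L}$), and the one that is the smallest binary number is called the $\mathcal{R}$-way arranged pattern (it begins with $\mathcal{L}$ and ends with $\mathcal{R}$). *)

(* Defs.v *)
From HB Require Import structures.
From mathcomp Require Import all_boot all_order all_algebra.
From mathcomp Require Import ring lra.
From mathcomp Require Import boolp classical_sets functions set_interval reals.

Set Implicit Arguments.
Unset Strict Implicit.
Unset Printing Implicit Defensive.

Import Order.TTheory GRing.Theory Num.Theory.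
Local Open Scope classical_set_scope.
Local Open Scope ring_scope.

(* [sL] codes the half-line ]-oo, 0] and [sR] the half-line ]0, +oo[. *)
Inductive letter := sL | sR.

Definition bit (s : letter) : nat := if s is sR then 1%N else 0%N.

(* Most significant digit first. *)
Definition binval (w : seq letter) : nat :=
  foldl (fun v s => (v.*2 + bit s)%N) 0%N w.

Definition cyclic_shift (w v : seq letter) : Prop := exists r, v = rot r w.

Definition L_way_arranged (w v : seq letter) : Prop :=
  cyclic_shift w v /\ forall u, cyclic_shift w u -> (binval u <= binval v)%N.

Definition R_way_arranged (w v : seq letter) : Prop :=
  cyclic_shift w v /\ forall u, cyclic_shift w u -> (binval v <= binval u)%N.

(* [rot i.+1 sigma] is the cyclic shift whose last letter is the one that sits
   at position [i] of [sigma]. *)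
Definition last_in_R_way n (sigma : n.-tuple letter) (i : 'I_n) : Prop :=
  R_way_arranged sigma (rot i.+1 sigma).

Definition last_in_L_way n (sigma : n.-tuple letter) (i : 'I_n) : Prop :=
  L_way_arranged sigma (rot i.+1 sigma).

Definition is_max (R : realType) (A : set R) (m : R) : Prop :=
  A m /\ ubound A m.

Definition is_min (R : realType) (A : set R) (m : R) : Prop :=
  A m /\ lbound A m.

Section Map.
Variables (R : realType) (a b : R).

Definition fmu (mu x : R) : R :=
  if x <= 0 then a * x + mu else b * x + mu - 1.

Definition is_periodic (mu p : R) (k : nat) : Prop :=
  [/\ (0 < k)%N, iter k (fmu mu) p = p &
      forall j, (0 < j < k)%N -> iter j (fmu mu) p <> p].

Definition side (x : R) : letter := if x <= 0 then sL else sR.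

Definition coding (mu p : R) (k : nat) : seq letter :=
  [seq side (iter i (fmu mu) p) | i <- iota 0 k].

Definition has_pattern (mu : R) (w : seq letter) : Prop :=
  exists (p : R) (k : nat),
    is_periodic mu p k /\ cyclic_shift (coding mu p k) w.

Definition pattern_set (w : seq letter) : set R :=
  [set mu | 0 < mu < 1 /\ has_pattern mu w].

Definition admissible (w : seq letter) : Prop := pattern_set w !=set0.

Definition branch (s : letter) (mu x : R) : R :=
  match s with sL => a * x + mu | sR => b * x + mu - 1 end.

(* [ordS i] is [i + 1] modulo [n]. *)
Definition cyclic_system n (sigma : n.-tuple letter) (mu : R)
    (x : 'I_n -> R) : Prop :=
  forall i, x (ordS i) = branch (tnth sigma i) mu (x i).

(* The solution of the cyclic system, which exists and is unique for [a] and
   [b] in ]0, 1[ by [cyclic_system_unique]. *)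
Definition position n (sigma : n.-tuple letter) (mu : R) : 'I_n -> R :=
  xget (fun=> 0) (cyclic_system sigma mu).

(* The parameter [mu] ranges over the whole line here: the bound arising from
   a position need not belong to ]0, 1[. *)
Definition lower_bound_at n (sigma : n.-tuple letter) (i : 'I_n) (m : R) :
    Prop :=
  tnth sigma i = sR /\ forall mu, 0 < position sigma mu i <-> m < mu.

Definition upper_bound_at n (sigma : n.-tuple letter) (i : 'I_n) (m : R) :
    Prop :=
  tnth sigma i = sL /\ forall mu, position sigma mu i <= 0 <-> mu <= m.

Definition lower_bounds n (sigma : n.-tuple letter) : set R :=
  [set m | exists i, lower_bound_at sigma i m].

Definition upper_bounds n (sigma : n.-tuple letter) : set R :=
  [set m | exists i, upper_bound_at sigma i m].

End Map.

Section WellDefined.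
Variables (R : realType) (a b : R).
Hypotheses (ha : 0 < a < 1) (hb : 0 < b < 1).

Let slope (s : letter) : R := if s is sR then b else a.
Let ofs (s : letter) : R := if s is sR then -1 else 0.

Let branchE s mu x : branch a b s mu x = slope s * x + mu + ofs s.
Proof. by case: s => /=; rewrite ?addr0. Qed.

Let slope01 s : 0 < slope s < 1.
Proof. by case: s. Qed.

Let pull (w : nat -> letter) (mu t : R) (j : nat) : R :=
  iteri j (fun i => branch a b (w i) mu) t.

Let pull_affine (w : nat -> letter) j : exists A B D,
  [/\ 0 < A <= 1, 0 <= B, (0 < j)%N -> A < 1 /\ 0 < B &
      forall mu t, pull w mu t j = A * t + B * mu + D].
Proof.
elim: j => [|j [A [B [D [/andP[A0 A1] B0 _ E]]]]].
  by exists 1, 0, 0; split=> // [|mu t]; [lra | rewrite /pull /=; ring].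
have /andP[s0 s1] := slope01 (w j).
exists (slope (w j) * A), (slope (w j) * B + 1), (slope (w j) * D + ofs (w j)).
have sA : slope (w j) * A < 1.
  by apply: le_lt_trans s1; rewrite ler_piMr // ltW.
have sB : 0 < slope (w j) * B + 1.
  by apply: ltr_wpDl => //; rewrite mulr_ge0 // ltW.
split=> //; [by rewrite mulr_gt0 //= ltW | exact: ltW |].
move=> mu t; have -> : pull w mu t j.+1 = branch a b (w j) mu (pull w mu t j) by [].
by rewrite branchE E; ring.
Qed.

Let solution_pull n (sigma : n.+1.-tuple letter) mu (x : 'I_n.+1 -> R) :
  cyclic_system a b sigma mu x ->
  let w := nth sL sigma in
  pull w mu (x ord0) n.+1 = x ord0 /\ forall i, x i = pull w mu (x ord0) i.
Proof.
move=> hx w.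
have E j : (j <= n)%N -> x (inord j) = pull w mu (x ord0) j.
  elim: j => [|j IH] jn; first by congr x; apply/val_inj; rewrite /= inordK.
  have -> : inord j.+1 = ordS (inord j : 'I_n.+1).
    apply/val_inj; rewrite /= !inordK ?modn_small //; exact: ltnW.
  rewrite hx IH ?(ltnW jn) // (tnth_nth sL) inordK //; exact: ltnW.
split=> [|i]; last by rewrite -E ?inord_val // -ltnS.
have -> : pull w mu (x ord0) n.+1 = branch a b (w n) mu (pull w mu (x ord0) n) by [].
rewrite -E // (_ : w n = tnth sigma (inord n)); last by rewrite (tnth_nth sL) inordK.
by rewrite -hx; congr x; apply/val_inj; rewrite /= inordK // modnn.
Qed.

Let solution n (sigma : n.+1.-tuple letter) : exists (c d : 'I_n.+1 -> R),
  (forall i, 0 < c i) /\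
  forall mu x, cyclic_system a b sigma mu x <-> x = (fun i => c i * mu + d i).
Proof.
set w := nth sL sigma.
have [A [B [D [/andP[A0 _] _ /(_ isT)[A1 B0] E]]]] := pull_affine w n.+1.
have nA : 1 - A != 0 by rewrite subr_eq0 gt_eqF.
pose t0 mu := (B * mu + D) / (1 - A).
have fix0 mu t : pull w mu t n.+1 = t <-> t = t0 mu.
  rewrite E; split=> [h|->]; last by rewrite /t0; field.
  by apply: (mulIf nA); rewrite /t0 divfK // mulrBr mulr1 -{1}h; ring.
have /choice[c /choice[d cd]] (i : 'I_n.+1) : exists c d, 0 < c /\
    forall mu, pull w mu (t0 mu) i = c * mu + d.
  have [A' [B' [D' [/andP[A'0 _] B'0 _ E']]]] := pull_affine w i.
  exists (A' * (B / (1 - A)) + B'), (A' * (D / (1 - A)) + D'); split.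
    by rewrite ltr_pwDl // mulr_gt0 // divr_gt0 // subr_gt0.
  by move=> mu; rewrite E' /t0; field.
exists c, d; split=> [i|mu x]; first by case: (cd i).
split=> [/solution_pull[/fix0 h hx]|-> i].
  by apply/funext => i; rewrite hx h; case: (cd i) => _ ->.
case: (cd i) => _ <-; case: (cd (ordS i)) => _ <-; rewrite (tnth_nth sL) /=.
have [i_n|] := ltnP i n; first by rewrite modn_small.
move=> n_i; have -> : i = n :> nat by apply/eqP; rewrite eqn_leq n_i -ltnS ltn_ord.
by rewrite modnn; apply/esym; exact/fix0.
Qed.

Lemma cyclic_system_unique n (sigma : n.-tuple letter) (mu : R) :
  exists! x : 'I_n -> R, cyclic_system a b sigma mu x.
Proof.
case: n sigma => [|n] sigma.
  by exists (fun=> 0); split=> [[]//|x _]; apply/funext => -[].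
have [c [d [_ h]]] := solution sigma.
by exists (fun i => c i * mu + d i); split=> [|x /h ->//]; exact/h.
Qed.

Lemma positionP n (sigma : n.-tuple letter) (mu : R) :
  cyclic_system a b sigma mu (position a b sigma mu).
Proof.
by have [x [hx _]] := cyclic_system_unique sigma mu; exact: (@xgetI _ _ _ x).
Qed.

Lemma position_affine n (sigma : n.-tuple letter) (i : 'I_n) :
  exists c d, 0 < c /\ forall mu, position a b sigma mu i = c * mu + d.
Proof.
case: n sigma i => [|n] sigma i; first by case: i.
have [c [d [c0 h]]] := solution sigma; exists (c i), (d i); split=> // mu.
by have /h -> := positionP sigma mu.
Qed.

Lemma lower_bound_unique n (sigma : n.-tuple letter) (i : 'I_n) :
  tnth sigma i = sR -> exists! m, lower_bound_at a b sigma i m.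
Proof.
move=> si; have [c [d [c0 h]]] := position_affine sigma i.
have H mu : 0 < position a b sigma mu i <-> - d / c < mu.
  by rewrite h ltr_pdivrMr // (mulrC mu); split=> ?; lra.
exists (- d / c); split=> // m [_ hm]; apply/le_anti/andP.
split; apply/negP => /negP; rewrite -ltNge.
- by move/hm/H; rewrite ltxx.
- by move/H/hm; rewrite ltxx.
Qed.

Lemma upper_bound_unique n (sigma : n.-tuple letter) (i : 'I_n) :
  tnth sigma i = sL -> exists! m, upper_bound_at a b sigma i m.
Proof.
move=> si; have [c [d [c0 h]]] := position_affine sigma i.
have H mu : position a b sigma mu i <= 0 <-> mu <= - d / c.
  by rewrite h ler_pdivlMr // (mulrC mu); split=> ?; lra.
exists (- d / c); split=> // m [_ hm]; apply/le_anti/andP.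
by split; [apply/hm/H | apply/H/hm].
Qed.

End WellDefined.

Lemma cyclic_shift_last n (sigma : n.+1.-tuple letter) w :
  cyclic_shift sigma w -> exists i : 'I_n.+1, w = rot i.+1 sigma.
Proof.
move=> [r ->]; have [r_big|r_small] := leqP n.+1 r.
  by exists ord_max; rewrite !rot_oversize ?size_tuple.
case: r r_small => [|r] r_small; last by exists (Ordinal (ltnW r_small)).
by exists ord_max; rewrite rot0 rot_oversize ?size_tuple.
Qed.

Lemma last_in_R_way_exists n (sigma : n.+1.-tuple letter) :
  exists i, last_in_R_way sigma i.
Proof.
have [//|i _ hi] := @arg_minnP _ (@ord0 n) predT
  (fun i => binval (rot i.+1 sigma)).
exists i; split=> [|_ /cyclic_shift_last[j ->]]; first by exists i.+1.
exact: hi.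
Qed.

Lemma last_in_L_way_exists n (sigma : n.+1.-tuple letter) :
  exists i, last_in_L_way sigma i.
Proof.
have [//|i _ hi] := @arg_maxnP _ (@ord0 n) predT
  (fun i => binval (rot i.+1 sigma)).
exists i; split=> [|_ /cyclic_shift_last[j ->]]; first by exists i.+1.
exact: hi.
Qed.

(* Main.v *)
(** At a parameter where every L position is [<= 0] and every R position is
    [>= 0], positions are weakly ordered like their forward words: at the first
    difference of two words the sign conditions order the points, and the
    increasing branches shared before it carry this order back.  Hence the last
    letter of the smallest shift sits at the smallest R position, and that of
    the largest shift at the largest L position.  At [mu1] some R position
    vanishes and at [mu2] some L position does, so these extreme ones vanish
    too.  The word of an admissible pattern is primitive, which gives the
    minimal period for every other parameter in the interval. *)
Require Import Defs.
From mathcomp Require Import all_boot all_order all_algebra.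
From mathcomp Require Import ring lra zify.
From mathcomp Require Import boolp classical_sets functions set_interval reals.
Import Order.TTheory GRing.Theory Num.Theory.
Local Open Scope classical_set_scope.
Local Open Scope ring_scope.

Set Implicit Arguments.
Unset Strict Implicit.
Unset Printing Implicit Defensive.

(** * Binary values and the lexicographic order of words *)

Lemma binval_rcons w s : binval (rcons w s) = ((binval w).*2 + bit s)%N.
Proof. by rewrite /binval foldl_rcons. Qed.

Lemma binval_cons s w : binval (s :: w) = (bit s * 2 ^ size w + binval w)%N.
Proof.
elim/last_ind: w => [|w t IH]; first by rewrite /binval /=; lia.
by rewrite -rcons_cons !binval_rcons IH size_rcons expnS; lia.
Qed.

Lemma binval_lt w : (binval w < 2 ^ size w)%N.
Proof.
elim/last_ind: w => [|w t IH] //.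
by rewrite binval_rcons size_rcons expnS; case: t => /=; lia.
Qed.

Lemma binval_eq0 w : binval w = 0%N -> all (fun s => bit s == 0%N) w.
Proof.
elim: w => [//|[] w IH]; rewrite binval_cons /=; first exact: IH.
by move=> /eqP; rewrite mul1n addn_eq0 expn_eq0.
Qed.

Lemma binval_max w : (2 ^ size w <= (binval w).+1)%N ->
  all (fun s => bit s == 1%N) w.
Proof.
elim: w => [//|s w IH]; rewrite binval_cons /= expnS.
have := binval_lt w; case: s => /=; first by lia.
by move=> h1 h2; apply: IH; lia.
Qed.

(** A leading bit outweighs any tail ([binval_lt]), so numerical order on words of equal length is
    lexicographic; [t] is the first difference. *)
Lemma binval_leP u v : size u = size v -> (binval u <= binval v)%N ->
  u = v \/ exists t, [/\ (t < size u)%N,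
    forall k, (k < t)%N -> nth sL u k = nth sL v k,
    nth sL u t = sL & nth sL v t = sR].
Proof.
elim: u v => [|s u IH] [|r v] //=; first by left.
move=> [suv]; rewrite !binval_cons suv.
have same : s = r -> (binval u <= binval v)%N -> s :: u = r :: v \/
    exists t, [/\ (t < (size v).+1)%N,
      forall k, (k < t)%N -> nth sL (s :: u) k = nth sL (r :: v) k,
      nth sL (s :: u) t = sL & nth sL (r :: v) t = sR].
  move=> -> /(IH _ suv)[->|[t [tu H ut vt]]]; [by left | right].
  by exists t.+1; split=> //; [rewrite ltnS -suv | case].
have := binval_lt v; have := binval_lt u; rewrite suv.
case: s r same => -[] same /=; rewrite ?mul1n ?mul0n ?add0n ?leq_add2l.
- by move=> _ _; exact: same.
- by move=> _ _ _; right; exists 0%N.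
- by lia.
- by move=> _ _; exact: same.
Qed.

(** * Cyclic indices and rotations *)

Lemma val_iter_ordS n (i : 'I_n) k :
  iter k (@ordS n) i = ((i + k) %% n)%N :> nat.
Proof.
elim: k => [|k IH]; first by rewrite addn0 modn_small.
by rewrite iterS /= IH -addn1 modnDml addn1 addnS.
Qed.

Lemma iter_ordS_size n (i : 'I_n) : iter n (@ordS n) i = i.
Proof. by apply/val_inj; rewrite /= val_iter_ordS modnDr modn_small. Qed.

(** The successor acts transitively on the indices: [j + (n - i)] steps lead from [i] to [j]. *)
Lemma ordS_ind n (P : 'I_n -> Prop) (i j : 'I_n) :
  (forall k, P k -> P (ordS k)) -> P i -> P j.
Proof.
move=> PS Pi; have {PS Pi} : P (iter (j + (n - i)) (@ordS n) i).
  by elim: addn => /=; auto.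
rewrite (_ : iter _ _ _ = j) //; apply/val_inj.
rewrite /= val_iter_ordS addnCA subnKC ?(ltnW (ltn_ord i)) //.
by rewrite modnDr modn_small.
Qed.

Section Rotation.
Variables (T : Type) (n : nat) (sigma : n.-tuple T).

Lemma nth_rot_tuple x0 (i : 'I_n) k : (k < n)%N ->
  nth x0 (rot (i : nat) sigma) k = tnth sigma (iter k (@ordS n) i).
Proof.
move=> kn; rewrite (tnth_nth x0) val_iter_ordS nth_cat size_drop size_tuple.
have hi := ltn_ord i; case: (ltnP k) => h.
  by rewrite nth_drop modn_small //; lia.
rewrite nth_take; last by lia.
congr nth; have -> : (i + k = (k - (n - i)) + n)%N by lia.
by rewrite modnDr modn_small //; lia.
Qed.

(** The two shift amounts differ only when [i.+1 = n], where both rotations are the identity. *)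
Lemma rot_ordS (i : 'I_n) : rot i.+1 sigma = rot (ordS i : nat) sigma.
Proof.
have [lt_in|] := ltnP i.+1 n; first by rewrite /= modn_small.
have := ltn_ord i => lt_in le_ni.
have e : i.+1 = n by apply/eqP; rewrite eqn_leq lt_in.
by rewrite /= e modnn rot0 rot_oversize ?size_tuple.
Qed.

End Rotation.

(** * Last letters of extremal shifts *)

Lemma all_rot T (p : pred T) r w : all p (rot r w) = all p w.
Proof. by rewrite /rot all_cat andbC -all_cat cat_take_drop. Qed.

Lemma tuple_rot_last n (sigma : n.-tuple letter) (i : 'I_n) : exists w,
  rot (i : nat) sigma = tnth sigma i :: w /\
  rot i.+1 sigma = rcons w (tnth sigma i).
Proof.
have n0 := leq_ltn_trans (leq0n _) (ltn_ord i).
have := nth_rot_tuple sigma sL i n0; rewrite rotS ?size_tuple //.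
have : size (rot (i : nat) sigma) = n by rewrite size_rot size_tuple.
case: (rot _ _) => [n_eq|s w _ /= <-]; first by rewrite -n_eq in n0.
by exists w; rewrite rot1_cons.
Qed.

(** Were the last letter [sL], moving it to the front would halve the value. Minimality then forces
    the value 0, so all letters are [sL], against [j]. *)
Lemma last_in_R_way_letter n (sigma : n.-tuple letter) i j :
  last_in_R_way sigma i -> tnth sigma j = sR -> tnth sigma i = sR.
Proof.
have [w [ri riS]] := tuple_rot_last sigma i.
move=> [_ /(_ (rot i sigma))]; rewrite riS => /(_ (ex_intro _ (i : nat) erefl)).
rewrite ri; case: (tnth sigma i) ri => // ri.
rewrite binval_rcons binval_cons /= => h.
have /binval_eq0 w0 : binval w = 0%N by lia.
have : all (fun s => bit s == 0%N) (rot (i : nat) sigma) by rewrite ri.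
by rewrite all_rot => /all_tnthP/(_ j) + sj; rewrite sj.
Qed.

(** Were the last letter [sR], comparison with its move to the front would give
    [2 ^ size w + v <= 2 * v + 1] for [v = binval w], so all letters would be [sR], against [j]. *)
Lemma last_in_L_way_letter n (sigma : n.-tuple letter) i j :
  last_in_L_way sigma i -> tnth sigma j = sL -> tnth sigma i = sL.
Proof.
have [w [ri riS]] := tuple_rot_last sigma i.
move=> [_ /(_ (rot i sigma))]; rewrite riS => /(_ (ex_intro _ (i : nat) erefl)).
rewrite ri; case: (tnth sigma i) ri => // ri.
rewrite binval_rcons binval_cons /= => h.
have /binval_max w1 : (2 ^ size w <= (binval w).+1)%N by lia.
have : all (fun s => bit s == 1%N) (rot (i : nat) sigma) by rewrite ri.
by rewrite all_rot => /all_tnthP/(_ j) + sj; rewrite sj.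
Qed.

(** * Contraction along a common word *)

Section Dynamics.
Variables (R : realType) (a b : R).
Hypotheses (ha : 0 < a < 1) (hb : 0 < b < 1).

(** [A] is the product of the slopes met along the word. Its positivity carries order between the
    two ends; [A < 1] makes the closed orbit of a word unique. *)
Lemma orbit_diff mu (w : nat -> letter) (y z : nat -> R) k :
  (forall j, (j < k)%N -> y j.+1 = branch a b (w j) mu (y j)) ->
  (forall j, (j < k)%N -> z j.+1 = branch a b (w j) mu (z j)) ->
  exists A, [/\ 0 < A <= 1, (0 < k)%N -> A < 1 &
    y k - z k = A * (y 0%N - z 0%N)].
Proof.
elim: k => [|k IH] hy hz; first by exists 1; split=> //; [lra | rewrite mul1r].
have [j jk|j jk|A [A01 _ E]] := IH; [exact/hy/ltnW | exact/hz/ltnW |].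
have step s : 0 < s < 1 -> y k.+1 - z k.+1 = s * (y k - z k) -> exists A,
    [/\ 0 < A <= 1, (0 < k.+1)%N -> A < 1 &
        y k.+1 - z k.+1 = A * (y 0%N - z 0%N)].
  move=> s01 es; exists (s * A); rewrite es E mulrA.
  by split=> //; [apply/andP; split |]; nra.
by rewrite hy ?hz // in step *; case: (w k) step => step;
  [apply: (step a ha) | apply: (step b hb)] => /=; ring.
Qed.

Lemma closed_orbit_unique mu (w : nat -> letter) (y z : nat -> R) k :
  (0 < k)%N ->
  (forall j, (j < k)%N -> y j.+1 = branch a b (w j) mu (y j)) ->
  (forall j, (j < k)%N -> z j.+1 = branch a b (w j) mu (z j)) ->
  y k = y 0%N -> z k = z 0%N -> y 0%N = z 0%N.
Proof.
move=> k0 hy hz yk zk; have [A [_ /(_ k0) A1 E]] := orbit_diff hy hz.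
by rewrite yk zk in E; nra.
Qed.

(** * Codings of periodic orbits and primitive words *)

Lemma branch_side mu x : branch a b (side x) mu x = fmu a b mu x.
Proof. by rewrite /side /fmu; case: ifP. Qed.

Lemma nth_coding mu p n k : (k < n)%N ->
  nth sL (coding a b mu p n) k = side (iter k (fmu a b mu) p).
Proof.
by move=> kn; rewrite (nth_map 0%N) ?size_iota // nth_iota.
Qed.

Lemma size_coding mu p n : size (coding a b mu p n) = n.
Proof. by rewrite size_map size_iota. Qed.

Lemma coding_inj mu p q n : (0 < n)%N -> iter n (fmu a b mu) p = p ->
  iter n (fmu a b mu) q = q -> coding a b mu p n = coding a b mu q n -> p = q.
Proof.
move=> n0 hp hq hpq; pose orb x j := iter j (fmu a b mu) x.
apply: (@closed_orbit_unique mu (fun j => side (orb p j)) (orb p) (orb q) n)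
  => // j jn.
  by rewrite branch_side.
by rewrite -(nth_coding _ _ jn) hpq nth_coding // branch_side.
Qed.

Lemma iter_modn (T : Type) (f : T -> T) n p k :
  iter n f p = p -> iter (k %% n) f p = iter k f p.
Proof.
move=> hp; rewrite {2}(divn_eq k n) addnC iterD; congr iter.
by elim: (k %/ n)%N => //= d IH; rewrite mulSn iterD -IH.
Qed.

Lemma rot_coding mu p n r : iter n (fmu a b mu) p = p -> (r <= n)%N ->
  rot r (coding a b mu p n) = coding a b mu (iter r (fmu a b mu) p) n.
Proof.
move=> hp rn; apply: (@eq_from_nth _ sL);
  rewrite size_rot !size_coding // => k kn.
rewrite nth_coding // -iterD nth_cat size_drop size_coding.
case: ltnP => h; first by rewrite nth_drop nth_coding 1?addnC //; lia.
rewrite nth_take ?nth_coding; [|lia..].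
have -> : (k + r = (k - (n - r)) + n)%N by lia.
by rewrite iterD hp.
Qed.

Lemma is_periodic_iter mu p n r : (r <= n)%N -> is_periodic a b mu p n ->
  is_periodic a b mu (iter r (fmu a b mu) p) n.
Proof.
move=> rn [n0 hp min]; split=> //; first by rewrite -iterD addnC iterD hp.
move=> j /min + h; apply.
have := f_equal (iter (n - r) (fmu a b mu)) h.
rewrite -!iterD subnK // hp -addnA (_ : _ + _ = j + n)%N; last by lia.
by rewrite iterD hp.
Qed.

(** This is the combinatorial form of minimality of the period. It does not mention [mu], so it
    passes from one parameter to all others. *)
Definition primitive n (sigma : n.-tuple letter) : Prop :=
  forall j, (0 < j < n)%N -> rot j sigma <> sigma.

Lemma position_orbit n (sigma : n.-tuple letter) mu (i : 'I_n) k :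
  (forall j, side (position a b sigma mu j) = tnth sigma j) ->
  iter k (fmu a b mu) (position a b sigma mu i) =
  position a b sigma mu (iter k (@ordS n) i).
Proof.
move=> hs; elim: k => [//|k IH].
by rewrite !iterS (positionP ha hb) IH -hs branch_side.
Qed.

(** Separates the sign conditions, which depend on [mu], from primitivity, which does not. *)
Lemma has_patternP n (sigma : n.+1.-tuple letter) mu :
  has_pattern a b mu sigma <->
  (forall i, side (position a b sigma mu i) = tnth sigma i) /\ primitive sigma.
Proof.
split=> [[p [k [hp [r er]]]]|[hs prim]].
  have kn : k = n.+1.
    by rewrite -(size_coding mu p k) -(size_rot r) -er size_tuple.
  rewrite {}kn in hp er.
  have {p r hp er} [p [n0 hp min] er] : exists2 p, is_periodic a b mu p n.+1 &
      sigma = coding a b mu p n.+1 :> seq _.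
    (* A shift by more than the length is the identity, so [p] itself then serves as starting
       point. *)
    have [rn|rn] := leqP r n.+1.
      exists (iter r (fmu a b mu) p); first exact: is_periodic_iter.
      by rewrite er rot_coding //; case: hp.
    by exists p => //; rewrite er rot_oversize // size_coding ltnW.
  pose x (i : 'I_n.+1) := iter i (fmu a b mu) p.
  have sx i : side (x i) = tnth sigma i.
    by rewrite (tnth_nth sL) er nth_coding.
  have hx : cyclic_system a b sigma mu x.
    move=> i; rewrite -sx branch_side /x /= -[fmu _ _ _ _]iterS.
    exact: iter_modn.
  have -> : position a b sigma mu = x.
    have [y [_ uniq]] := cyclic_system_unique ha hb sigma mu.
    by rewrite -(uniq _ (positionP ha hb sigma mu)) (uniq _ hx).
  (* If rotation by [j] fixed [sigma], then [p] and its [j]-th iterate would have equal codings,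
     hence coincide, against minimality of the period. *)
  split=> // j /[dup] /andP[_ jn] /min hj ej; apply: hj.
  apply: (@coding_inj mu _ _ n.+1) => //.
    by rewrite -iterD addnC iterD hp.
  by rewrite -rot_coding ?(ltnW jn) // -er.
have hp : iter n.+1 (fmu a b mu) (position a b sigma mu ord0) =
    position a b sigma mu ord0.
  by rewrite position_orbit // iter_ordS_size.
have cod : coding a b mu (position a b sigma mu ord0) n.+1 = sigma.
  apply: (@eq_from_nth _ sL); rewrite size_coding ?size_tuple // => k kn.
  rewrite nth_coding // position_orbit // hs (tnth_nth sL) val_iter_ordS.
  by rewrite add0n modn_small.
exists (position a b sigma mu ord0), n.+1; split; last first.
  by exists 0%N; rewrite rot0 cod.
split=> // j /[dup] /andP[_ jn] /prim hj ej; apply: hj.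
by rewrite -{1}cod rot_coding ?(ltnW jn) // ej cod.
Qed.

(** * Order of positions and order of words *)

Section Order.
Variables (n : nat) (sigma : n.-tuple letter) (mu : R).
Let x := position a b sigma mu.
Hypothesis xL : forall i, tnth sigma i = sL -> x i <= 0.
(** The inequality is weak so that the section applies at [mu1], where an R position vanishes. *)
Hypothesis xR : forall i, tnth sigma i = sR -> 0 <= x i.

Lemma position_le_binval (i j : 'I_n) :
  (binval (rot (i : nat) sigma) <= binval (rot (j : nat) sigma))%N ->
  x i <= x j.
Proof.
pose y (i : 'I_n) k := x (iter k (@ordS n) i).
have ystep i' k : y i' k.+1 =
    branch a b (tnth sigma (iter k (@ordS n) i')) mu (y i' k).
  exact: (positionP ha hb).
have szr r : size (rot r sigma) = n by rewrite size_rot size_tuple.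
move=> /binval_leP; rewrite !szr => /(_ erefl)[eij|[t [tn pre ti tj]]].
  have n0 := leq_ltn_trans (leq0n _) (ltn_ord i).
  rewrite (_ : x i = x j) //.
  apply: (@closed_orbit_unique mu (nth sL (rot (i : nat) sigma)) (y i) (y j) n)
    => // [k kn|k kn||].
  - by rewrite nth_rot_tuple.
  - by rewrite eij nth_rot_tuple.
  - by rewrite /y iter_ordS_size.
  - by rewrite /y iter_ordS_size.
(* At the first difference [t] the signs give [y i t <= 0 <= y j t]; the factor [A > 0] pulls this
   back to time 0. *)
have [k kt|k kt|A [A01 _ E]] :=
    @orbit_diff mu (nth sL (rot (i : nat) sigma)) (y i) (y j) t.
- by rewrite nth_rot_tuple // (ltn_trans kt).
- by rewrite pre // nth_rot_tuple // (ltn_trans kt).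
rewrite nth_rot_tuple // in ti; rewrite nth_rot_tuple // in tj.
have := xL ti; have := xR tj; rewrite -/(y i t) -/(y j t).
by have : y i 0%N - y j 0%N = x i - x j by []; nra.
Qed.

(** The shift ending at [i] starts at [ordS i], so the words compare the images of [i] and [j]. Both
    carry [sR], and cancelling that common increasing branch compares the positions themselves. *)
Lemma last_in_R_way_le i j : last_in_R_way sigma i -> tnth sigma j = sR ->
  x i <= x j.
Proof.
move=> /[dup] hi [_ /(_ (rot j.+1 sigma) (ex_intro _ _ erefl)) le_ij] sj.
have si := last_in_R_way_letter hi sj.
rewrite !rot_ordS in le_ij; have := position_le_binval le_ij.
rewrite /x !(positionP ha hb) si sj /= -!addrA lerD2r ler_pM2l //;
  by case/andP: hb.
Qed.

Lemma last_in_L_way_ge i j : last_in_L_way sigma i -> tnth sigma j = sL ->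
  x j <= x i.
Proof.
move=> /[dup] hi [_ /(_ (rot j.+1 sigma) (ex_intro _ _ erefl)) le_ij] sj.
have si := last_in_L_way_letter hi sj.
rewrite !rot_ordS in le_ij; have := position_le_binval le_ij.
rewrite /x !(positionP ha hb) si sj /= lerD2r ler_pM2l //; by case/andP: ha.
Qed.

End Order.

(** * Bounds as zeros of positions, and the range of the parameter *)

Lemma position_mono n (sigma : n.-tuple letter) i :
  {mono position a b sigma ^~ i : mu nu / mu <= nu}.
Proof.
have [c [d [c0 E]]] := position_affine ha hb sigma i => mu nu.
by rewrite !E lerD2r ler_pM2l.
Qed.

Lemma lower_bound_atP n (sigma : n.-tuple letter) i m :
  lower_bound_at a b sigma i m <->
  tnth sigma i = sR /\ position a b sigma m i = 0.
Proof.
split=> -[si h]; split=> //; last first.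
  by move=> mu; rewrite -h !ltNge position_mono.
have [c [d [c0 E]]] := position_affine ha hb sigma i.
(* The position is [c * mu + d], with zero [- d / c]. Testing the equivalence [h] at this zero and
   at [m] forces them to agree. *)
have z : position a b sigma (- d / c) i = 0.
  by rewrite E; field; exact: lt0r_neq0.
have zm : - d / c <= m by rewrite leNgt; apply/negP => /h; rewrite z ltxx.
have : position a b sigma m i <= 0.
  by rewrite leNgt; apply/negP => /h; rewrite ltxx.
by rewrite -{1}z position_mono => mz; rewrite (_ : m = - d / c) //;
  apply/le_anti/andP.
Qed.

Lemma upper_bound_atP n (sigma : n.-tuple letter) i m :
  upper_bound_at a b sigma i m <->
  tnth sigma i = sL /\ position a b sigma m i = 0.
Proof.
split=> -[si h]; split=> //; last by move=> mu; rewrite -h position_mono.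
have [c [d [c0 E]]] := position_affine ha hb sigma i.
have z : position a b sigma (- d / c) i = 0.
  by rewrite E; field; exact: lt0r_neq0.
have /h : position a b sigma (- d / c) i <= 0 by rewrite z.
have := h m; rewrite lexx => -[_ /(_ isT)].
by rewrite -{1}z position_mono => mz zm; rewrite (_ : m = - d / c) //;
  apply/le_anti/andP.
Qed.

(** For [mu <= 0] the image of an L position is again L, and for [mu >= 1] that of an R position is
    again R. Either way one letter would fill the whole cycle. *)
Lemma sides_param01 n (sigma : n.-tuple letter) mu iL iR :
  (forall i, side (position a b sigma mu i) = tnth sigma i) ->
  tnth sigma iL = sL -> tnth sigma iR = sR -> 0 < mu < 1.
Proof.
have /andP[a0 _] := ha; have /andP[b0 _] := hb.
move=> hs sigL sigR; rewrite !ltNge; apply/andP; split; apply/negP => hmu.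
  suff : tnth sigma iR = sL by rewrite sigR.
  apply: (@ordS_ind _ (fun i => tnth sigma i = sL) iL iR _ sigL) => i si.
  rewrite -hs (positionP ha hb) si /= /side ifT //.
  by move: (hs i); rewrite si /side; case: leP => // x0 _; nra.
suff : tnth sigma iL = sR by rewrite sigL.
apply: (@ordS_ind _ (fun i => tnth sigma i = sR) iR iL _ sigR) => i si.
rewrite -hs (positionP ha hb) si /= /side ifF //; apply/negbTE; rewrite -ltNge.
by move: (hs i); rewrite si /side;
  case: (leP (position _ _ _ _ i)) => // x0 _; nra.
Qed.

End Dynamics.

Unset Implicit Arguments.

Theorem lemma7 (R : realType) (a b : R) (n : nat) (sigma : n.-tuple letter)
    (mu1 mu2 : R)
    (ha : 0 < a < 1) (hb : 0 < b < 1)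
    (hsigma : admissible a b sigma)
    (hmu1 : is_max (lower_bounds a b sigma) mu1)
    (hmu2 : is_min (upper_bounds a b sigma) mu2) :
  [/\ pattern_set a b sigma = [set` `]mu1, mu2]],
      forall i : 'I_n, last_in_R_way sigma i ->
        lower_bound_at a b sigma i mu1 &
      forall i : 'I_n, last_in_L_way sigma i ->
        upper_bound_at a b sigma i mu2].
Proof.
case: n sigma hsigma hmu1 hmu2 => [|n] sigma hsigma
  [[iR lbR] max1] [[iL ubL] min2].
  by case: iR lbR.
have [sigR hR] := lbR; have [sigL hL] := ubL.
have /(lower_bound_atP ha hb)[_ zR] := lbR.
have /(upper_bound_atP ha hb)[_ zL] := ubL.
pose x := position a b sigma.
have posR mu i : mu1 < mu -> tnth sigma i = sR -> 0 < x mu i.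
  move=> mu1_lt /(lower_bound_unique ha hb)[m [[si hm] _]]; apply/hm.
  by apply: le_lt_trans mu1_lt; apply: max1; exists i.
have negL mu i : mu <= mu2 -> tnth sigma i = sL -> x mu i <= 0.
  move=> mu2_ge /(upper_bound_unique ha hb)[m [[si hm] _]]; apply/hm.
  by apply: le_trans mu2_ge _; apply: min2; exists i.
have sides mu : mu1 < mu <= mu2 <-> forall i, side (x mu i) = tnth sigma i.
  split=> [/andP[lt1 le2] i|hs].
    rewrite /side; case E : (tnth sigma i); first by rewrite negL.
    by rewrite leNgt posR.
  apply/andP; split; [apply/hR | apply/hL].
    by move: (hs iR); rewrite sigR /side; case: leP.
  by move: (hs iL); rewrite sigL /side; case: leP.
(* Admissibility is used at a single parameter [mu0]: it yields primitivity and [mu1 < mu2]. *)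
have [mu0 [_ /(has_patternP ha hb)[/sides/andP[lt1 le2] prim]]] := hsigma.
have lt12 := lt_le_trans lt1 le2.
split.
- apply/seteqP; split=> mu /=; rewrite in_itv /=.
    by move=> [_ /(has_patternP ha hb)[/sides]].
  move=> /sides hs; split; first exact: (sides_param01 ha hb hs sigL sigR).
  exact/has_patternP.
- move=> i hi; have si := last_in_R_way_letter hi sigR.
  (* Each R position vanishes at its own bound, which is at most [mu1], and increases with the
     parameter. *)
  have R0 j : tnth sigma j = sR -> 0 <= x mu1 j.
    move=> sj; have [m [lbm _]] := lower_bound_unique ha hb sj.
    have /(lower_bound_atP ha hb)[_ <-] := lbm.
    by rewrite position_mono //; apply: max1; exists j.
  apply/(lower_bound_atP ha hb); split=> //; apply/le_anti.
  (* The position [iR] attaining the maximum vanishes at [mu1], and the extremal position lies below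
     it. *)
  rewrite R0 // andbT -zR.
  by apply: (last_in_R_way_le ha hb) hi sigR => // j; apply: negL; exact: ltW.
- move=> i hi; have si := last_in_L_way_letter hi sigL.
  apply/(upper_bound_atP ha hb); split=> //; apply/le_anti.
  (* Dually, [iL] vanishes at [mu2] and the extremal L position lies above it; R positions are
     positive there since [mu1 < mu2]. *)
  rewrite negL // -zL.
  by apply: (last_in_L_way_ge ha hb) hi sigL => j sj;
    [exact: negL | exact/ltW/posR].
Qed.
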